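(* The central measure of $[0,1]$ of a second kind, $\lambda_{[0,1]}$, coincides with the Lebesgue measure on $[0,1]$ (where $[0,1]$ carries its natural metric $|x-y|$).
   Context: For a compact metric space $(X,d)$ let $X^{(1)}$ be the set of orbits of points of $X$ under the group of all isometries of $X$ onto $X$, with canonical projection $\pi_X^{(1)}\colon X\to X^{(1)}$, and let $d^{(1)}$ be the greatest pseudometric on $X^{(1)}$ for which $\pi_X^{(1)}$ is nonexpansive (for compact $X$ it is a metric, and $(X^{(1)},d^{(1)})$ is compact). Put $(X^{(0)},d^{(0)})=(X,d)$ and $(X^{(n)},d^{(n)})=\bigl((X^{(n-1)})^{(1)},(d^{(n-1)})^{(1)}\bigr)$ for $n>0$. The space $X$ is quasi-nilpotent if the diameters of $X^{(n)}$ tend to $0$ as $n\to\infty$. The interval $[0,1]$ is quasi-nilpotent. For a nonempty compact metric space $(X,d)$ let $\mathrm{Prob}(X)$ be the set of all Borel probability measures on $X$ with the Kantorovich metric $$\widehat d(\mu,\nu)=\sup\Bigl\{\Bigl|\int_X f\,d\mu-\int_X f\,d\nu\Bigr| : f\colon X\to\mathbb{R},\ |f(x)-f(y)|\le d(x,y)\ \text{for all } x,y\in X\Bigr\};$$ it is compact and affinely isometric to a convex subset of a normed linear space. For a convex subset $K$ of a normed linear space (or a space affinely isometric to one) let $\mathrm{Fix}(K)$ be the set of all points of $K$ fixed by every affine isometry of $K$ onto $K$; this is again a convex set (with the restricted metric). Put $\mathrm{Fix}^0(K):=K$, $\mathrm{Fix}^n(K):=\mathrm{Fix}(\mathrm{Fix}^{n-1}(K))$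 for $n>0$, $\mathrm{Fix}^\infty(K):=\bigcap_{n=0}^\infty\mathrm{Fix}^n(K)$, and $\Delta(X):=\mathrm{Fix}^\infty(\mathrm{Prob}(X))$. If $X$ is nonempty and quasi-nilpotent, $\Delta(X)$ consists of exactly one measure, denoted $\lambda_X$ and called the central measure of $X$ of a second kind. *)

(* Defs.v *)
From HB Require Import structures.
From mathcomp Require Import all_boot all_order all_algebra.
From mathcomp Require Import interval_inference.
From mathcomp Require Import all_classical all_reals all_analysis.
From mathcomp Require Import measurable_realfun ring.

Set Implicit Arguments.
Unset Strict Implicit.
Unset Printing Implicit Defensive.

Import Order.TTheory GRing.Theory Num.Def Num.Theory.
Import numFieldNormedType.Exports.

Local Open Scope classical_set_scope.
Local Open Scope ring_scope.
Local Open Scope convex_scope.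

(* The base point only records that the metric space is nonempty (the library
   generates sigma-algebras on pointed types). *)
#[short(type="pmetricType")]
HB.structure Definition PointedMetric (R : numDomainType) :=
  {M of Metric R M & isPointed M}.

Section Fix.
Context {R : realType} {V : convType R} (dist : V -> V -> R).
Implicit Types (K : set V) (Phi : V -> V).

(* Only the restriction of Phi to K matters; it ranges over all affine
   isometries of K onto K since every map K -> K extends to V. *)
Definition affine_isometry K Phi : Prop :=
  [/\ Phi @` K = K,
      forall x y, K x -> K y -> dist (Phi x) (Phi y) = dist x y &
      forall x y (t : {i01 R}), K x -> K y ->
        Phi (x <| t |> y) = Phi x <| t |> Phi y].

Definition Fix K : set V :=
  [set x | K x /\ forall Phi, affine_isometry K Phi -> Phi x = x].

Definition Fix_infty K : set V := \bigcap_(n in [set: nat]) iter n Fix K.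

End Fix.

Definition Borel (R : realType) (X : pmetricType R) :
  measurableType (@open X).-sigma := g_sigma_algebraType (@open X).

(* A library measure is a function defined on all subsets, unconstrained outside
   the sigma-algebra.  Requiring it to vanish there gives each Borel measure
   exactly one representative, so that = is equality of Borel measures. *)
Record Prob (R : realType) (X : pmetricType R) := MkProb {
  prob_measure :> probability (Borel X) R ;
  prob_outE : forall A : set (Borel X), ~ measurable A -> prob_measure A = 0%E }.

Section trim.
Context (R : realType) d (T : measurableType d) (mu : probability T R).

Definition trim (A : set T) : \bar R := if `[< measurable A >] then mu A else 0%E.

Lemma trimE A : measurable A -> trim A = mu A.
Proof. by move=> mA; rewrite /trim; case: asboolP. Qed.

Let trim0 : trim set0 = 0%E.
Proof. by rewrite trimE ?measure0. Qed.

Let trim_ge0 A : (0 <= trim A)%E.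
Proof. by rewrite /trim; case: ifP. Qed.

Let trim_sigma_additive : semi_sigma_additive trim.
Proof.
move=> F mF tF mUF; rewrite trimE//.
rewrite [X in X @ _](_ : _ = (fun n => \sum_(0 <= i < n) mu (F i))%E).
  exact: measure_semi_sigma_additive.
by apply/funext => n; apply: eq_bigr => i _; rewrite trimE.
Qed.

HB.instance Definition _ := isMeasure.Build _ _ _ trim
  trim0 trim_ge0 trim_sigma_additive.

Let trim_setT : trim setT = 1%E.
Proof. by rewrite trimE ?probability_setT. Qed.

HB.instance Definition _ := Measure_isProbability.Build _ _ _ trim trim_setT.

End trim.

Section Prob_of.
Context (R : realType) (X : pmetricType R).

Let trim_out (mu : probability (Borel X) R) (A : set (Borel X)) :
  ~ measurable A -> trim mu A = 0%E.
Proof. by move=> mA; rewrite /trim; case: asboolP. Qed.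

Definition Prob_of (mu : probability (Borel X) R) : Prob X :=
  MkProb (@trim_out mu).

Lemma Prob_ofE (mu : probability (Borel X) R) (A : set (Borel X)) :
  measurable A -> Prob_of mu A = mu A.
Proof. exact: trimE. Qed.

Lemma Prob_eqP (mu nu : Prob X) :
  (forall A : set (Borel X), measurable A -> mu A = nu A) -> mu = nu.
Proof.
case: mu nu => [mu muo] [nu nuo] /= h.
have : (mu : set _ -> \bar R) = nu.
  apply/funext => A; have [mA|mA] := pselect (measurable A); first exact: h.
  by rewrite muo// nuo.
move: mu nu muo nuo {h} =>
  [f [[a1 a2] [a3] [a4] [a5] [a6] [a7] [a8]]] [g [[b1 b2] [b3] [b4] [b5] [b6] [b7] [b8]]].
move=> /= muo nuo fg; subst g.
have ? : b1 = a1 by exact: Prop_irrelevance. subst b1.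
have ? : b2 = a2 by exact: Prop_irrelevance. subst b2.
have ? : b3 = a3 by exact: Prop_irrelevance. subst b3.
have ? : b4 = a4 by exact: Prop_irrelevance. subst b4.
have ? : b5 = a5 by exact: Prop_irrelevance. subst b5.
have ? : b6 = a6 by exact: Prop_irrelevance. subst b6.
have ? : b7 = a7 by exact: Prop_irrelevance. subst b7.
have ? : b8 = a8 by exact: Prop_irrelevance. subst b8.
by rewrite (Prop_irrelevance muo nuo).
Qed.

End Prob_of.

Section mixture.
Context (R : realType) d (T : measurableType d).
Context (t : {i01 R}) (mu nu : probability T R).

Definition mixture (A : set T) : \bar R :=
  (t%:num%:E * mu A + (1 - t%:num)%:E * nu A)%E.

Let t_ge0 : 0 <= t%:num. Proof. by []. Qed.
Let onem_ge0 : 0 <= 1 - t%:num. Proof. by rewrite subr_ge0. Qed.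

Let mixtureE : mixture =
  measure_add (mscale (NngNum t_ge0) mu) (mscale (NngNum onem_ge0) nu).
Proof. by apply/funext => A; rewrite measure_addE. Qed.

Let mixture0 : mixture set0 = 0%E.
Proof. by rewrite mixtureE /measure_add measure0. Qed.

Let mixture_ge0 A : (0 <= mixture A)%E.
Proof. by rewrite mixtureE /measure_add measure_ge0. Qed.

Let mixture_sigma_additive : semi_sigma_additive mixture.
Proof. by rewrite mixtureE /measure_add; exact: measure_semi_sigma_additive. Qed.

HB.instance Definition _ := isMeasure.Build _ _ _ mixture
  mixture0 mixture_ge0 mixture_sigma_additive.

Let mixture_setT : mixture setT = 1%E.
Proof.
by rewrite /mixture !probability_setT !mule1 -EFinD addrC subrK.
Qed.

HB.instance Definition _ :=
  Measure_isProbability.Build _ _ _ mixture mixture_setT.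

End mixture.

Section Prob_convex.
Context (R : realType) (X : pmetricType R).

HB.instance Definition _ := gen_eqMixin (Prob X).
HB.instance Definition _ := gen_choiceMixin (Prob X).

Definition Prob_conv (t : {i01 R}) (mu nu : Prob X) : Prob X :=
  Prob_of (mixture t mu nu).

Lemma Prob_convE t mu nu (A : set (Borel X)) : measurable A ->
  Prob_conv t mu nu A = (t%:num%:E * mu A + (1 - t%:num)%:E * nu A)%E.
Proof. exact: Prob_ofE. Qed.

Let Prob_conv1 mu nu : Prob_conv 1%:i01 mu nu = mu.
Proof.
by apply: Prob_eqP => A mA; rewrite Prob_convE//= subrr mul0e adde0 mul1e.
Qed.

Let Prob_convmm t mu : Prob_conv t mu mu = mu.
Proof.
apply: Prob_eqP => A mA; rewrite Prob_convE// -ge0_muleDl ?lee_fin ?subr_ge0//.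
by rewrite -EFinD addrC subrK mul1e.
Qed.

Let Prob_convC t mu nu : Prob_conv t mu nu = Prob_conv (1 - t%:num)%:i01 nu mu.
Proof. by apply: Prob_eqP => A mA; rewrite !Prob_convE//= subKr addeC. Qed.

Let Prob_convA : convex_quasi_associative Prob_conv.
Proof.
move=> p q r s mu nu rho pE sE; apply: Prob_eqP => A mA; rewrite !Prob_convE//.
rewrite -(fineK (fin_num_measure mu A mA)) -(fineK (fin_num_measure nu A mA)).
rewrite -(fineK (fin_num_measure rho A mA)) -!(EFinM, EFinD).
congr EFin; have := ConvexQuasiAssoc.pq_sr pE sE.
have {}sE : 1 - s%:num = (1 - p%:num) * (1 - q%:num) := sE.
rewrite sE pE => h; move: (fine _) (fine _) (fine _) => x y z.
rewrite [LHS](_ : _ = r%:num * s%:num * z + ((1 - r%:num * s%:num) * q%:num) * y +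
  (1 - r%:num * s%:num) * (1 - q%:num) * x); last by ring.
by rewrite h; ring.
Qed.

HB.instance Definition _ := isConvexSpace.Build R (Prob X)
  Prob_conv1 Prob_convmm Prob_convC Prob_convA.

End Prob_convex.

Section Kantorovich.
Context {R : realType} {X : pmetricType R}.

Definition nonexpansive (f : X -> R) : Prop :=
  forall x y, `|f x - f y| <= mdist x y.

(* For compact X the set below is nonempty and bounded, so sup is its least
   upper bound. *)
Definition kantorovich (mu nu : Prob X) : R :=
  sup [set `|\int[mu]_x f x - \int[nu]_x f x| | f in nonexpansive].

End Kantorovich.

Definition Delta (R : realType) (X : pmetricType R) : set (Prob X) :=
  Fix_infty kantorovich [set: Prob X].
Arguments Delta {R} X.

Definition central_measure2 (R : realType) (X : pmetricType R)
  (lambda : Prob X) : Prop := Delta X = [set lambda].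

Definition unit_interval (R : realType) : Type := set_type `[0 : R, 1]%classic.

Section unit_interval.
Context (R : realType).
Local Notation I01 := (unit_interval R).

HB.instance Definition _ :=
  PseudoMetric.copy I01 (set_type `[0 : R, 1]%classic).

Let dist (x y : I01) : R := `|\val x - \val y|.

Let dist_ge0 x y : 0 <= dist x y.
Proof. exact: normr_ge0. Qed.

Let dist_eq0 x y : dist x y = 0 -> x = y.
Proof. by move/normr0_eq0/subr0_eq/val_inj. Qed.

Let ball_dist (x : I01) d : ball x d = [set y | dist x y < d].
Proof. by []. Qed.

HB.instance Definition _ :=
  PseudoMetric_isMetric.Build R I01 dist_ge0 dist_eq0 ball_dist.

Lemma unit_interval_mdistE (x y : I01) : mdist x y = `|\val x - \val y|.
Proof. by []. Qed.

Let zero_in : (0 : R) \in `[0 : R, 1]%classic.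
Proof. by apply/mem_set; rewrite /= in_itv/= lexx ler01. Qed.

HB.instance Definition _ := isPointed.Build I01 (exist _ 0 zero_in).

End unit_interval.

Section lebesgue01.
Context (R : realType).
Local Notation I01 := (unit_interval R).
Local Notation val := (\val : I01 -> R).

Lemma val_preimage_image (B : set R) : val @` (val @^-1` B) = B `&` `[0, 1].
Proof.
apply/seteqP; split => [_ [x Bx <-]|x [Bx x01]].
  by split => //; exact: (set_mem (valP x)).
by exists (exist _ x (mem_set x01)).
Qed.

Lemma measurable_image_val (A : set (Borel I01)) :
  measurable A -> measurable (val @` A).
Proof.
suff : <<s @open I01 >> `<=` [set A | measurable (val @` A)] by exact.
apply: smallest_sub => [|U [B oB <-]]; last first.
  rewrite /= val_preimage_image; apply: measurableI => //.
  exact: open_measurable.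
split => [|U mU|F mF] /=.
- by rewrite image_set0.
- rewrite setTD [X in measurable X](_ : _ = `[0, 1] `\` val @` U).
    exact: measurableD.
  apply/seteqP; split => [_ [x Ux <-]|x [x01 Ux]].
    split; first exact: (set_mem (valP x)).
    by move=> [y Uy /val_inj yx]; apply: Ux; rewrite -yx.
  exists (exist _ x (mem_set x01)) => // ?.
  by apply: Ux; exists (exist _ x (mem_set x01)).
- by rewrite image_bigcup; apply: bigcup_measurable => i _; exact: mF.
Qed.

Definition lebesgue01_fun (A : set (Borel I01)) : \bar R :=
  lebesgue_measure (val @` A).

Let lebesgue01_0 : lebesgue01_fun set0 = 0%E.
Proof. by rewrite /lebesgue01_fun image_set0 measure0. Qed.

Let lebesgue01_ge0 A : (0 <= lebesgue01_fun A)%E.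
Proof. exact: measure_ge0. Qed.

Let lebesgue01_sigma_additive : semi_sigma_additive lebesgue01_fun.
Proof.
move=> F mF tF mUF; rewrite /lebesgue01_fun image_bigcup.
apply: measure_semi_sigma_additive.
- by move=> i; exact: measurable_image_val.
- apply/trivIsetP => i j _ _ ij.
  rewrite -subset0 => _ [[x Fx <-] [y Fy /val_inj yx]].
  move/trivIsetP : tF => /(_ i j Logic.I Logic.I ij) /seteqP[+ _].
  by move=> /(_ x); apply; split => //; rewrite -yx.
- by apply: bigcup_measurable => i _; exact: measurable_image_val.
Qed.

HB.instance Definition _ := isMeasure.Build _ _ _ lebesgue01_fun
  lebesgue01_0 lebesgue01_ge0 lebesgue01_sigma_additive.

Let lebesgue01_setT : lebesgue01_fun setT = 1%E.
Proof.
rewrite /lebesgue01_fun -(preimage_setT val) val_preimage_image setTI.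
by rewrite lebesgue_measure_itv/= lte_fin ltr01 oppr0 adde0.
Qed.

HB.instance Definition _ :=
  Measure_isProbability.Build _ _ _ lebesgue01_fun lebesgue01_setT.

Definition lebesgue01 : Prob (unit_interval R) := Prob_of lebesgue01_fun.

Lemma lebesgue01E (A : set (Borel I01)) :
  measurable A -> lebesgue01 A = lebesgue_measure (val @` A).
Proof. exact: Prob_ofE. Qed.

End lebesgue01.

(* Main.v *)
(** For a probability measure mu on [0,1] let [spread mu] be the average of the
    images of mu under x |-> x/2 and x |-> 1 - x/2.  This map is affine, divides
    Kantorovich distances by 2, and its image is the set of measures invariant under
    the flip x |-> 1 - x.  An affine isometry of Prob([0,1]) is the identity or is
    induced by the flip: it permutes the only two measures at distance 1, namely
    the Dirac measures at 0 and 1; if it fixes both, it preserves means and the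
    measures on the chord between them, hence every Dirac measure, hence the
    functions c |-> int |x - c| dmu, which determine mu.  So
    Fix(Prob([0,1])) = spread(Prob([0,1])), and as spread is an affine dilation the
    n-th iterated Fix is the image of spread^n.  The diameters of these images tend
    to 0 and each of them contains Lebesgue measure, which spread fixes. *)
Require Import Defs.
From HB Require Import structures.
From mathcomp Require Import all_boot all_order all_algebra.
From mathcomp Require Import interval_inference.
From mathcomp Require Import all_classical all_reals all_analysis.
From mathcomp Require Import measurable_realfun ring lra.

Set Implicit Arguments.
Unset Strict Implicit.
Unset Printing Implicit Defensive.

Import Order.TTheory GRing.Theory Num.Def Num.Theory.
Import numFieldNormedType.Exports.

Local Open Scope classical_set_scope.
Local Open Scope ring_scope.
Local Open Scope convex_scope.

(** * Fixed points and affine dilations *)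

Section dilation.
Context {R : realType} {V : convType R} (dist : V -> V -> R).
Variables (T S : V -> V) (k : R).
Hypothesis TK : cancel T S.
Hypothesis T_affine : forall x y (t : {i01 R}), T (x <| t |> y) = T x <| t |> T y.
Hypothesis k_neq0 : k != 0.
Hypothesis T_dist : forall x y, dist (T x) (T y) = k * dist x y.

(** Conjugation by [T] matches the affine isometries of [K] with those of the image: [Psi] becomes
    [T \o Psi \o S], and [Phi] becomes [S \o Phi \o T]. The factor [k] appears on both sides of each
    distance equation and cancels. *)
Lemma Fix_dilation (K : set V) : Fix dist (T @` K) = T @` Fix dist K.
Proof.
apply/seteqP; split=> [_ [[x Kx <-] Tx_fixed]|_ [x [Kx x_fixed] <-]].
  exists x => //; split=> // Psi [PsiK Psi_dist Psi_affine].
  apply: (can_inj TK); have := Tx_fixed (T \o Psi \o S); rewrite /= TK; apply.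
  split=> [|_ _ [y Ky <-] [z Kz <-]|_ _ t [y Ky <-] [z Kz <-]] /=.
  - rewrite -[in RHS]PsiK; apply/seteqP;
    split=> [_ [_ [y Ky <-] <-]|_ [_ [y Ky <-] <-]].
      by exists (Psi y); [exists y|rewrite /= TK].
    by exists (T y); [exists y|rewrite /= TK].
  - by rewrite !TK !T_dist Psi_dist.
  - by rewrite -T_affine !TK Psi_affine// T_affine.
split=> [|Phi [PhiK Phi_dist Phi_affine]]; first by exists x.
(* [S] is known to invert [T] only on the image of [T], so each value [Phi (T y)] is first written
   as [T z] with [z] in [K]. *)
have PhiT y : K y -> exists2 z, K z & T z = Phi (T y).
  move=> Ky; suff : (T @` K) (Phi (T y)) by [].
  by rewrite -PhiK; exists (T y) => //; exists y.
have [x' Kx' Tx'] := PhiT _ Kx; rewrite -Tx'; congr T.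
have <- : (S \o Phi \o T) x = x' by rewrite /= -Tx' TK.
apply: x_fixed; split=> [|y z Ky Kz|y z t Ky Kz] /=.
- apply/seteqP; split=> [_ [y Ky <-]|y Ky].
    by have [z Kz /= <-] := PhiT _ Ky; rewrite TK.
  have : (T @` K) (T y) by exists y.
  by rewrite -PhiK => -[_ [z Kz <-] PhiTz]; exists z => //=; rewrite PhiTz TK.
- have [y' Ky' Ty'] := PhiT _ Ky; have [z' Kz' Tz'] := PhiT _ Kz.
  rewrite -Ty' -Tz' !TK; apply: (mulfI k_neq0); rewrite -!T_dist Ty' Tz'.
  by rewrite Phi_dist.
- have [y' Ky' Ty'] := PhiT _ Ky; have [z' Kz' Tz'] := PhiT _ Kz.
  rewrite T_affine Phi_affine//.
  by rewrite -Ty' -Tz' -T_affine !TK.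
Qed.

Lemma iter_Fix_dilation (K : set V) n :
  Fix dist K = T @` K -> iter n (Fix dist) K = iter n T @` K.
Proof.
move=> FixK.
have iterS m : iter m.+1 T @` K = T @` (iter m T @` K) by rewrite image_comp.
elim: n => [|n IHn]; first by rewrite image_id.
rewrite iterS [LHS]/= {}IHn.
(* This inner induction pulls one [Fix] out through the [n] copies of [T]; its base case is
   [FixK]. *)
elim: n => [|n IHn]; first by rewrite image_id.
by rewrite iterS Fix_dilation IHn.
Qed.

End dilation.

(** * Expectations of bounded measurable functions *)

Section bounded_measurable.
Context d (T : measurableType d) (R : realType).
Implicit Types (f g : T -> R) (mu : probability T R).

(** A class stable under the arithmetic below and integrable for every probability measure, so that
    integrability conditions do not depend on the measure. *)
Definition bounded_measurable f :=
  measurable_fun setT f /\ exists M : R, forall x, `|f x| <= M.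

Lemma bounded_measurable_integrable mu f :
  bounded_measurable f -> mu.-integrable setT (EFin \o f).
Proof.
move=> [mf [M fM]]; apply: measurable_bounded_integrable => //.
  exact: le_lt_trans (probability_le1 mu _) (ltry 1).
exists M; split; first exact: num_real.
by move=> y My x _ /=; exact: le_trans (fM x) (ltW My).
Qed.

Lemma bounded_measurable_cst (c : R) : bounded_measurable (fun=> c).
Proof. by split; [exact: measurable_cst|exists `|c|]. Qed.

Lemma bounded_measurableD f g : bounded_measurable f -> bounded_measurable g ->
  bounded_measurable (fun x => f x + g x).
Proof.
move=> [mf [M fM]] [mg [N gN]]; split; first exact: measurable_funD.
by exists (M + N) => x; exact: le_trans (ler_normD _ _) (lerD _ _).
Qed.

Lemma bounded_measurableM f g : bounded_measurable f -> bounded_measurable g ->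
  bounded_measurable (fun x => f x * g x).
Proof.
move=> [mf [M fM]] [mg [N gN]]; split; first exact: measurable_funM.
by exists (M * N) => x; rewrite normrM ler_pM.
Qed.

Lemma bounded_measurableB f g : bounded_measurable f -> bounded_measurable g ->
  bounded_measurable (fun x => f x - g x).
Proof.
move=> [mf [M fM]] [mg [N gN]]; split; first exact: measurable_funB.
by exists (M + N) => x; exact: le_trans (ler_normB _ _) (lerD _ _).
Qed.

Lemma bounded_measurable_norm f : bounded_measurable f ->
  bounded_measurable (fun x => `|f x|).
Proof.
move=> [mf [M fM]]; split; first exact: measurableT_comp.
by exists M => x; rewrite normr_id.
Qed.

Lemma expect_cst mu (c : R) : \int[mu]_x c = c.
Proof. by rewrite Rintegral_cst//= probability_setT mulr1. Qed.

Lemma expectD mu f g : bounded_measurable f -> bounded_measurable g ->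
  \int[mu]_x (f x + g x) = \int[mu]_x f x + \int[mu]_x g x.
Proof. by move=> bf bg; rewrite RintegralD//; exact: bounded_measurable_integrable. Qed.

Lemma expectB mu f g : bounded_measurable f -> bounded_measurable g ->
  \int[mu]_x (f x - g x) = \int[mu]_x f x - \int[mu]_x g x.
Proof. by move=> bf bg; rewrite RintegralB//; exact: bounded_measurable_integrable. Qed.

Lemma expectZ mu f (c : R) : bounded_measurable f ->
  \int[mu]_x (c * f x) = c * \int[mu]_x f x.
Proof. by move=> bf; rewrite RintegralZl//; exact: bounded_measurable_integrable. Qed.

Lemma le_expect mu f g : bounded_measurable f -> bounded_measurable g ->
  (forall x, f x <= g x) -> \int[mu]_x f x <= \int[mu]_x g x.
Proof.
by move=> bf bg fg; apply: le_Rintegral => // *; exact: bounded_measurable_integrable.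
Qed.

Lemma le_norm_expect mu f : bounded_measurable f ->
  `|\int[mu]_x f x| <= \int[mu]_x `|f x|.
Proof.
by move=> bf; apply: le_normr_Rintegral => //; exact: bounded_measurable_integrable.
Qed.

(** Adding the bound [M] makes [f] nonnegative, and nonnegative functions integrate additively
    against a sum of scaled measures. The shift is undone at the end because all three measures have
    mass 1. *)
Lemma expect_mixture mu nu (t : {i01 R}) f : bounded_measurable f ->
  \int[mixture t mu nu]_x f x =
  t%:num * \int[mu]_x f x + (1 - t%:num) * \int[nu]_x f x.
Proof.
move=> [mf [M fM]].
have s_ge0 : 0 <= 1 - t%:num by rewrite subr_ge0.
have t_ge0 : 0 <= t%:num by [].
have bf : bounded_measurable f by split => //; exists M.
have bM := bounded_measurable_cst M.
have bfM := bounded_measurableD bf bM.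
have fM_ge0 x : 0 <= f x + M.
  by rewrite -[f x]opprK addrC subr_ge0 (le_trans _ (fM x))// -normrN ler_norm.
have fME (m : probability T R) : \int[m]_x f x = \int[m]_x (f x + M) - M.
  by rewrite expectD// expect_cst addrK.
suff mixtureM : \int[mixture t mu nu]_x (f x + M) =
    t%:num * \int[mu]_x (f x + M) + (1 - t%:num) * \int[nu]_x (f x + M).
  by rewrite !fME mixtureM; ring.
have mfM : measurable_fun setT (fun x => (f x + M)%:E).
  by apply/measurable_EFinP; case: bfM.
have fin (m : probability T R) : (\int[m]_x (f x + M)%:E \is a fin_num)%E.
  by apply: integrable_fin_num => //; exact: bounded_measurable_integrable.
rewrite /Rintegral (@eq_measure_integral _ _ _ _ (measure_add
  (mscale (NngNum t_ge0) mu) (mscale (NngNum s_ge0) nu))); last first.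
  by move=> A _ _; apply: etrans (esym (measure_addE
    (mscale (NngNum t_ge0) mu) (mscale (NngNum s_ge0) nu) A)) _.
rewrite ge0_integral_measure_add//; last by move=> x _; rewrite lee_fin.
rewrite !ge0_integral_mscale//; try by move=> x _; rewrite lee_fin.
rewrite fineD ?fin_numM ?fin// !fineM ?fin//.
Qed.

End bounded_measurable.

(** * Points of the interval and nonexpansive functions on it *)

Section unit_interval_points.
Context (R : realType).
Local Notation I01 := (unit_interval R).
Local Notation val := (\val : I01 -> R).

Lemma unit_interval_bounds (x : I01) : 0 <= val x <= 1.
Proof. by have := set_mem (valP x); rewrite /= in_itv. Qed.

Let clamp_subproof (y : R) : Num.min 1 (Num.max 0 y) \in `[0 : R, 1]%classic.
Proof. by apply/mem_set; rewrite /= in_itv/= le_min ler01 le_max lexx ge_min lexx. Qed.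

(** The nearest-point retraction of the line onto the interval. It names points by reals without
    carrying a membership proof, and it extends functions on the interval to the line. *)
Definition clamp (y : R) : I01 := exist _ (Num.min 1 (Num.max 0 y)) (clamp_subproof y).

Lemma clampE (y : R) : 0 <= y <= 1 -> val (clamp y) = y.
Proof. by move=> /andP[y0 y1] /=; rewrite max_r// min_r. Qed.

Lemma clamp_val (x : I01) : clamp (val x) = x.
Proof. by apply: val_inj; rewrite clampE// unit_interval_bounds. Qed.

Lemma le_norm_clamp (y z : R) : `|val (clamp y) - val (clamp z)| <= `|y - z|.
Proof.
have := ler_norm (y - z); have := ler_norm (z - y); rewrite (distrC z y) /= => yz zy.
rewrite ler_norml; case: (leP 0 y) => y0; case: (leP 0 z) => z0;
  by case: (leP 1 y) => y1; case: (leP 1 z) => z1;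
    rewrite ?(min_r ler01); apply/andP; split; lra.
Qed.

Lemma measurable_val : measurable_fun setT (val : Borel I01 -> R).
Proof.
apply: (measurability _ (RGenOpens.measurableE R)).
move=> _ [_ [x [y ->]] <-]; rewrite setTI; apply: sub_sigma_algebra.
by exists `]x, y[%classic => //; exact: itv_open.
Qed.

Lemma measurable_val_comp d (T : measurableType d) (f : T -> Borel I01) :
  measurable_fun setT (val \o f) -> measurable_fun setT f.
Proof.
move=> mf _ A mA; rewrite setTI.
have -> : f @^-1` A = (val \o f) @^-1` (val @` A).
  apply/seteqP; split=> [x Ax|x [y Ay /val_inj yx]] /=; first by exists (f x).
  by rewrite -yx.
by rewrite -[X in measurable X]setTI; apply: mf => //; exact: measurable_image_val.
Qed.

Lemma nonexpansive_bounded_measurable (f : I01 -> R) :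
  nonexpansive f -> bounded_measurable (f : Borel I01 -> R).
Proof.
move=> f1; split; last first.
  exists (`|f (clamp 0)| + 1) => x.
  rewrite -[f x](subrK (f (clamp 0))); apply: le_trans (ler_normD _ _) _.
  rewrite addrC lerD2l.
  apply: le_trans (f1 _ _) _; rewrite unit_interval_mdistE clampE ?lexx ?ler01//.
  by have /andP[x0 x1] := unit_interval_bounds x; rewrite subr0 ger0_norm.
(* The extension [f \o clamp] to the line is continuous because [clamp] is nonexpansive, hence it is
   Borel. *)
have -> : f = (f \o clamp) \o val by apply/funext => x /=; rewrite clamp_val.
apply: (measurableT_comp _ measurable_val); apply: continuous_measurable_fun => y.
apply/cvgrPdist_le => e e0; near=> z.
apply: le_trans (f1 _ _) _; apply: le_trans (le_norm_clamp _ _) _.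
near: z; exact: cvgr_dist_le.
Unshelve. all: by end_near. Qed.

Lemma val_bounded_measurable : bounded_measurable (val : Borel I01 -> R).
Proof. by apply: nonexpansive_bounded_measurable => x y. Qed.

Lemma nonexpansive_norm (c : R) : nonexpansive (fun x : I01 => `|val x - c|).
Proof.
move=> x y; rewrite unit_interval_mdistE; apply: le_trans (ler_dist_dist _ _) _.
by rewrite opprB addrA subrK.
Qed.

End unit_interval_points.

(** * Upper rays determine a measure *)

Section upper_rays.
Context (R : realType).
Local Notation I01 := (unit_interval R).
Local Notation val := (\val : I01 -> R).
Implicit Types mu nu : Prob I01.

Lemma measurable_upper_ray (a : R) : measurable [set x : Borel I01 | a <= val x].
Proof.
rewrite [X in measurable X](_ : _ = setT `&` val @^-1` `[a, +oo[).
  by apply: measurable_val.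
by rewrite setTI; apply/seteqP; split=> x /=; rewrite in_itv/= andbT.
Qed.

(** Closed upper rays are stable under intersection and generate the Borel sets of the line, so the
    uniqueness theorem for measures applies to the distributions of [val]. Rays starting outside
    [[0, 1]] cut out the empty set or the whole interval. *)
Lemma Prob_upper_ray_inj mu nu :
  (forall a, 0 <= a <= 1 ->
     mu [set x | a <= val x] = nu [set x | a <= val x]) -> mu = nu.
Proof.
move=> mu_nu; apply: Prob_eqP => A mA.
have mval := @measurable_val R.
have valA : A = val @^-1` (val @` A).
  by apply/seteqP; split=> [x Ax|x [y Ay /val_inj <-]] //; exists x.
pose Val : {mfun Borel I01 >-> R} := HB.pack (val : Borel I01 -> R)
   (isMeasurableFun.Build _ _ _ _ _ mval).
have -> : mu A = distribution mu Val (val @` A) by rewrite [in LHS]valA.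
have -> : nu A = distribution nu Val (val @` A) by rewrite [in LHS]valA.
apply: (measure_unique (@RGenCInfty.G R) (fun n => `[- n%:R, +oo[%classic)).
- exact: RGenCInfty.measurableE.
- move=> _ _ [x ->] [y ->]; exists (Num.max x y).
  apply/seteqP; split=> z /=; rewrite !in_itv/= !andbT ge_max.
    by move=> [-> ->].
  by move=> /andP[].
- by move=> n; exists (- n%:R).
- rewrite -subTset => x _; exists (Num.bound `|x|) => //=.
  by rewrite in_itv/= andbT lerNl (le_trans (ler_norm _))// normrN ltW// archi_boundP.
- move=> _ [a ->].
  suff : mu [set x | a <= val x] = nu [set x | a <= val x].
    rewrite (_ : [set x | _] = val @^-1` `[a, +oo[%classic)//.
    by apply/seteqP; split=> x /=; rewrite in_itv/= andbT.
  have [a1|a1] := leP a 1; last first.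
    suff -> : [set x : I01 | a <= val x] = set0 by rewrite !measure0.
    rewrite -subset0 => x /= ax.
    by have /andP[_] := unit_interval_bounds x; rewrite leNgt (lt_le_trans a1).
  have [a0|a0] := leP 0 a; first by apply: mu_nu; rewrite a0.
  suff -> : [set x : I01 | a <= val x] = setT by rewrite !probability_setT.
  rewrite -subTset => x _ /=; have /andP[x0 _] := unit_interval_bounds x.
  exact: le_trans (ltW a0) x0.
- move=> n; exact: le_lt_trans (probability_le1 (distribution mu Val) _) (ltry 1).
- exact: measurable_image_val.
Qed.

End upper_rays.

(** * Dirac measures and push-forwards *)

Section push.
Context (R : realType) (X : pmetricType R).
Implicit Types (mu nu : Prob X) (f : Borel X -> R).

Lemma expect_Prob_of (m : probability (Borel X) R) f :
  \int[Prob_of m]_x f x = \int[m]_x f x.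
Proof.
by congr fine; apply: eq_measure_integral => A mA _; exact: Prob_ofE.
Qed.

Lemma expect_conv (t : {i01 R}) mu nu f : bounded_measurable f ->
  \int[mu <| t |> nu]_x f x =
  t%:num * \int[mu]_x f x + (1 - t%:num) * \int[nu]_x f x.
Proof. by move=> bf; rewrite expect_Prob_of expect_mixture. Qed.

Definition Dirac (x : X) : Prob X := Prob_of (\d_(x : Borel X)).

Lemma expect_Dirac (x : X) f : bounded_measurable f -> \int[Dirac x]_y f y = f x.
Proof.
move=> [mf _]; rewrite expect_Prob_of /Rintegral integral_dirac//.
  by rewrite diracT mul1e.
exact/measurable_EFinP.
Qed.

Definition push (phi : {mfun Borel X >-> Borel X}) mu : Prob X :=
  Prob_of (distribution mu phi).

Lemma pushE (phi : {mfun Borel X >-> Borel X}) mu (A : set (Borel X)) :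
  measurable A -> push phi mu A = mu (phi @^-1` A).
Proof. by move=> mA; rewrite /push Prob_ofE. Qed.

Lemma measurable_mfun_preimage (phi : {mfun Borel X >-> Borel X}) (A : set (Borel X)) :
  measurable A -> measurable (phi @^-1` A).
Proof. by move=> mA; exact: measurable_funPTI. Qed.

Lemma expect_push (phi : {mfun Borel X >-> Borel X}) mu f : bounded_measurable f ->
  \int[push phi mu]_x f x = \int[mu]_x f (phi x).
Proof.
move=> [mf [M fM]]; rewrite expect_Prob_of; congr fine.
apply: integral_distribution; first exact/measurable_EFinP.
apply: bounded_measurable_integrable; split; first exact: measurableT_comp.
by exists M => x; exact: fM.
Qed.

Lemma push_conv (phi : {mfun Borel X >-> Borel X}) (t : {i01 R}) mu nu :
  push phi (mu <| t |> nu) = push phi mu <| t |> push phi nu.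
Proof.
apply: Prob_eqP => A mA; have mphiA := measurable_mfun_preimage phi mA.
by rewrite pushE// !Prob_convE// !pushE.
Qed.

Lemma push_comp (phi psi chi : {mfun Borel X >-> Borel X}) mu :
  (forall x, phi (psi x) = chi x) -> push phi (push psi mu) = push chi mu.
Proof.
move=> phipsi; apply: Prob_eqP => A mA; have mphiA := measurable_mfun_preimage phi mA.
by rewrite !pushE//; congr (mu _); apply/funext => x /=; rewrite -phipsi.
Qed.

Lemma push_id (phi psi : {mfun Borel X >-> Borel X}) mu :
  cancel psi phi -> push phi (push psi mu) = mu.
Proof.
move=> psiK; apply: Prob_eqP => A mA; have mphiA := measurable_mfun_preimage phi mA.
by rewrite !pushE//; congr (mu _); apply/funext => x /=; rewrite psiK.
Qed.

End push.

(** * The Kantorovich distance on the interval *)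

Section kantorovich_unit_interval.
Context (R : realType).
Local Notation I01 := (unit_interval R).
Local Notation val := (\val : I01 -> R).
Local Notation mean mu := (\int[mu]_x val x).
Implicit Types (mu nu : Prob I01) (f : I01 -> R).

(* Uses |x - y| <= x (1 - y) + y (1 - x) on the unit square: the right-hand side
   is affine in each variable, so that only the means of mu and nu matter. *)
Lemma nonexpansive_expect_diff mu nu f : nonexpansive f ->
  `|\int[mu]_x f x - \int[nu]_x f x| <=
  mean mu * (1 - mean nu) + mean nu * (1 - mean mu).
Proof.
move=> f1; have bf := nonexpansive_bounded_measurable f1.
have bv := val_bounded_measurable R.
have bc c := @bounded_measurable_cst _ (Borel I01) R c.
have bM := bounded_measurableM; have bD := bounded_measurableD.
have bB := bounded_measurableB; have bN := bounded_measurable_norm.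
have pointwise x : `|f x - \int[nu]_y f y| <=
    val x * (1 - mean nu) + (1 - val x) * mean nu.
  rewrite -[f x](expect_cst nu) -expectB//; apply: le_trans (le_norm_expect _ _) _.
    exact: bB.
  have -> : val x * (1 - mean nu) + (1 - val x) * mean nu =
      \int[nu]_y (val x + (1 - 2 * val x) * val y).
    by rewrite expectD ?expect_cst ?expectZ//; [ring|exact: bM].
  apply: le_expect => [||y]; [exact/bN/bB|by apply: bD => //; exact: bM|].
  apply: le_trans (f1 _ _) _; rewrite unit_interval_mdistE.
  have /andP[x0 x1] := unit_interval_bounds x.
  have /andP[y0 y1] := unit_interval_bounds y.
  by rewrite ler_norml; apply/andP; split; nra.
rewrite -[X in _ - X](expect_cst mu) -expectB//.
apply: le_trans (le_norm_expect _ _) _; first exact: bB.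
have -> : mean mu * (1 - mean nu) + mean nu * (1 - mean mu) =
    \int[mu]_x (mean nu + (1 - 2 * mean nu) * val x).
  by rewrite expectD ?expect_cst ?expectZ//; [ring|exact: bM].
apply: le_expect => [||x]; [exact/bN/bB|by apply: bD => //; exact: bM|].
by apply: le_trans (pointwise x) _; rewrite le_eqVlt; apply/orP; left; apply/eqP; ring.
Qed.

Lemma mean_bounds mu : 0 <= mean mu <= 1.
Proof.
have bv := val_bounded_measurable R; apply/andP; split.
  by apply: Rintegral_ge0 => x _; have /andP[] := unit_interval_bounds x.
rewrite -[leRHS](expect_cst mu); apply: le_expect => // [|x].
  exact: bounded_measurable_cst.
by have /andP[] := unit_interval_bounds x.
Qed.

Lemma le_kantorovich mu nu f : nonexpansive f ->
  `|\int[mu]_x f x - \int[nu]_x f x| <= kantorovich mu nu.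
Proof.
move=> f1; apply: ub_le_sup; last by exists f.
(* An upper bound uniform in the test function is required, since [sup] of an unbounded set is only
   a default value. *)
exists (mean mu * (1 - mean nu) + mean nu * (1 - mean mu)) => _ [g g1 <-].
exact: nonexpansive_expect_diff.
Qed.

Lemma kantorovich_le mu nu (M : R) :
  (forall f, nonexpansive f -> `|\int[mu]_x f x - \int[nu]_x f x| <= M) ->
  kantorovich mu nu <= M.
Proof.
move=> muM; apply: ge_sup => [|_ [f f1 <-]]; last exact: muM.
(* The zero function shows that the set of values is nonempty. *)
exists `|\int[mu]_x 0 - \int[nu]_x 0|, (fun=> 0) => // x y.
by rewrite subrr normr0 unit_interval_mdistE.
Qed.

Lemma kantorovich_le_means mu nu :
  kantorovich mu nu <= mean mu * (1 - mean nu) + mean nu * (1 - mean mu).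
Proof. by apply: kantorovich_le => f; exact: nonexpansive_expect_diff. Qed.

Lemma kantorovich_le1 mu nu : kantorovich mu nu <= 1.
Proof.
apply: le_trans (kantorovich_le_means _ _) _.
have /andP[? ?] := mean_bounds mu; have /andP[? ?] := mean_bounds nu; nra.
Qed.

Lemma kantorovich_ge0 mu nu : 0 <= kantorovich mu nu.
Proof.
have v1 : nonexpansive val by move=> x y.
exact: le_trans (normr_ge0 _) (le_kantorovich mu nu v1).
Qed.

(** The function [|val x - val c|] is extremal: it is nonexpansive, vanishes at [c], and dominates
    [|f x - f c|] for every nonexpansive [f]. *)
Lemma kantorovich_Dirac mu (c : I01) :
  kantorovich mu (Dirac c) = \int[mu]_x `|val x - val c|.
Proof.
have n1 := @nonexpansive_norm R (val c).
have bn := nonexpansive_bounded_measurable n1.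
apply/eqP; rewrite eq_le; apply/andP; split.
  apply: kantorovich_le => f f1; have bf := nonexpansive_bounded_measurable f1.
  have bc := @bounded_measurable_cst _ (Borel I01) R (f c).
  rewrite expect_Dirac// -[X in _ - X](expect_cst mu) -expectB//.
  apply: le_trans (le_norm_expect _ _) _; first exact: bounded_measurableB.
  apply: le_expect => [||x]; [|exact: bn|exact: f1].
  exact/bounded_measurable_norm/bounded_measurableB.
have := le_kantorovich mu (Dirac c) n1; rewrite expect_Dirac// subrr normr0 subr0.
exact: le_trans (ler_norm _).
Qed.

Lemma expect_indic mu (A : set (Borel I01)) : measurable A ->
  mu A = (\int[mu]_x \1_A x)%:E.
Proof.
move=> mA; rewrite /Rintegral integral_indic//= setIT fineK//.
exact: fin_num_measure.
Qed.

(* The ramp 1/2 + (|x - (a - e)| - |x - a|) / (2 e), which climbs from 0 to 1 on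
   [a - e, a], separates the two rays. *)
Lemma expect_norm_ray mu nu (a e : R) : 0 < e ->
  (forall c, c \in [:: a - e; a] ->
     \int[mu]_x `|val x - c| = \int[nu]_x `|val x - c|) ->
  (mu [set x | (a <= val x)%R] <= nu [set x | (a - e <= val x)%R])%E.
Proof.
move=> e0 mu_nu.
have mray := @measurable_upper_ray R.
have bn c := nonexpansive_bounded_measurable (@nonexpansive_norm R c).
have bi (A : set (Borel I01)) : measurable A -> bounded_measurable (\1_A : Borel I01 -> R).
  move=> mA; split; first exact: measurable_indic.
  by exists 1 => x; rewrite indicE; case: (_ \in _); rewrite ?normr1 ?normr0.
have bc c := @bounded_measurable_cst _ (Borel I01) R c.
pose h (x : Borel I01) := 2^-1 + (2 * e)^-1 * (`|val x - (a - e)| - `|val x - a|).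
have bh : bounded_measurable h.
  apply: bounded_measurableD => //; apply: bounded_measurableM => //.
  exact: bounded_measurableB.
have hE : \int[mu]_x h x = \int[nu]_x h x.
  rewrite /h !expectD ?expect_cst//;
    try by apply: bounded_measurableM => //; exact: bounded_measurableB.
  rewrite !expectZ ?expectB//; try exact: bounded_measurableB.
  by rewrite !mu_nu ?inE ?eqxx ?orbT.
have ie : (2 * e)^-1 * (2 * e) = 1 by rewrite mulVf// mulf_neq0// gt_eqF.
have i0 : 0 < (2 * e)^-1 by rewrite invr_gt0 mulr_gt0.
have hl x : a <= val x -> 1 <= h x.
  move=> ax; rewrite /h; suff -> : `|val x - (a - e)| - `|val x - a| = e by nra.
  by rewrite !ger0_norm; lra.
have hge0 x : 0 <= h x.
  have : `|val x - (a - e)| - `|val x - a| >= - e.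
    by case: (ger0P (val x - a)); case: (ger0P (val x - (a - e))); lra.
  by rewrite /h; nra.
have hle1 x : h x <= 1.
  have : `|val x - (a - e)| - `|val x - a| <= e.
    by case: (ger0P (val x - a)); case: (ger0P (val x - (a - e))); lra.
  by rewrite /h; nra.
have hr x : val x < a - e -> h x <= 0.
  move=> ax; rewrite /h; suff -> : `|val x - (a - e)| - `|val x - a| = - e by nra.
  by rewrite !ltr0_norm; lra.
rewrite !expect_indic//; rewrite lee_fin.
apply: (@le_trans _ _ (\int[mu]_x h x)).
  apply: le_expect; [exact/bi|exact: bh|] => x; rewrite indicE.
  by case: (boolP (x \in _)) => [/set_mem/hl|_].
rewrite hE; apply: le_expect; [exact: bh|exact/bi|] => x; rewrite indicE.
case: (boolP (x \in _)) => [//|]; rewrite notin_setE/= => /negP.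
by rewrite -ltNge => /hr.
Qed.

(** By [expect_norm_ray], the mass that one measure gives to a ray is at most the mass that the
    other gives to slightly larger rays. Continuity from above removes the enlargement, and
    exchanging the two measures gives equality on all rays. *)
Lemma expect_norm_inj mu nu :
  (forall c : I01, \int[mu]_x `|val x - val c| = \int[nu]_x `|val x - val c|) ->
  mu = nu.
Proof.
suff le_ray (mu' nu' : Prob I01) (a : R) :
    (forall c : I01, \int[mu']_x `|val x - val c| = \int[nu']_x `|val x - val c|) ->
    0 < a <= 1 -> (mu' [set x | (a <= val x)%R] <= nu' [set x | (a <= val x)%R])%E.
  move=> mu_nu; apply: Prob_upper_ray_inj => a /andP[].
  rewrite le_eqVlt => /predU1P[<- _|a0 a1]; last first.
    by apply/eqP; rewrite eq_le !le_ray ?a0.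
  suff -> : [set x : I01 | 0 <= val x] = setT by rewrite !probability_setT.
  by rewrite -subTset => x _ /=; have /andP[] := unit_interval_bounds x.
move=> mu_nu /andP[a0 a1].
(* The enlargement is proportional to [a], so that [a - a / n.+1] stays in [[0, 1]], the only range
   of centres covered by the hypothesis. *)
pose F n : set (Borel I01) := [set x | a - a * n.+1%:R^-1 <= val x].
have capF : \bigcap_n F n = [set x | a <= val x].
  apply/seteqP; split=> [x Fx|x /= ax n _]; last first.
    by rewrite /F /=; apply: le_trans ax; rewrite gerBl mulr_ge0// ltW.
  rewrite /= leNgt; apply/negP => xa.
  (* With this [N] the enlargement [a / N.+1] is smaller than [a - val x], so [x] would lie outside
     [F N]. *)
  pose N := Num.bound (a / (a - val x)).
  have ax0 : 0 < a - val x by rewrite subr_gt0.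
  have := Fx N Logic.I; rewrite /F /= lerBlDr -lerBlDl; apply/negP; rewrite -ltNge.
  rewrite ltr_pdivrMr// mulrC -ltr_pdivrMr//.
  apply: (@lt_trans _ _ N%:R); last by rewrite ltr_nat.
  by apply: archi_boundP; rewrite divr_ge0// ltW.
have : nu' (F n) @[n --> \oo] --> nu' (\bigcap_n F n).
  have mF n : measurable (F n) by exact: measurable_upper_ray.
  apply: nonincreasing_cvg_mu => //.
  - exact: le_lt_trans (probability_le1 nu' (mF 0%N)) (ltry 1).
  - exact: bigcapT_measurable.
  - move=> m n mn; apply/subsetPset => x; rewrite /F /=; apply: le_trans.
    by rewrite lerD2l lerN2 ler_pM2l// lef_pV2 ?posrE// ler_nat.
rewrite capF => cvgF.
apply: (cvge_ge _ cvgF); near=> n.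
apply: expect_norm_ray; first by rewrite mulr_gt0.
have e0 : 0 < n.+1%:R^-1 :> R by rewrite invr_gt0.
have e1 : n.+1%:R^-1 <= 1 :> R by rewrite invf_le1// ler1n.
move=> c; rewrite !inE => /orP[]/eqP->.
  rewrite -(@clampE R (a - a * n.+1%:R^-1)) ?mu_nu//.
  by rewrite subr_ge0 ger_pMr// e1 lerBlDr ler_wpDr// mulr_ge0// ltW.
by rewrite -(@clampE R a) ?mu_nu// a1 ltW.
Unshelve. all: by end_near. Qed.

Lemma kantorovich_eq0 mu nu : kantorovich mu nu = 0 -> mu = nu.
Proof.
move=> d0; apply: expect_norm_inj => c; apply/eqP; rewrite -subr_eq0 -normr_eq0.
by rewrite eq_le normr_ge0 andbT -[leRHS]d0; apply: le_kantorovich; exact: nonexpansive_norm.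
Qed.

End kantorovich_unit_interval.

(** * The two halving maps, the flip, the tent map and [spread] *)

Section tent.
Context (R : realType).
Local Notation I01 := (unit_interval R).
Local Notation val := (\val : I01 -> R).
Implicit Types (x : Borel I01) (mu nu : Prob I01) (f : I01 -> R).

Definition lhalf x : Borel I01 := clamp (2^-1 * val x).
Definition rhalf x : Borel I01 := clamp (1 - 2^-1 * val x).
Definition flip x : Borel I01 := clamp (1 - val x).
Definition tent x : Borel I01 := clamp (1 - `|1 - 2 * val x|).

Lemma val_lhalf x : val (lhalf x) = 2^-1 * val x.
Proof. by rewrite clampE//; have := unit_interval_bounds x; lra. Qed.

Lemma val_rhalf x : val (rhalf x) = 1 - 2^-1 * val x.
Proof. by rewrite clampE//; have := unit_interval_bounds x; lra. Qed.

Lemma val_flip x : val (flip x) = 1 - val x.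
Proof. by rewrite clampE//; have := unit_interval_bounds x; lra. Qed.

Lemma val_tent x : val (tent x) = 1 - `|1 - 2 * val x|.
Proof.
rewrite clampE//; have := unit_interval_bounds x.
by case: (ger0P (1 - 2 * val x)); lra.
Qed.

Let bounded_measurable_half : bounded_measurable (fun x => 2^-1 * val x).
Proof.
apply: bounded_measurableM; first exact: bounded_measurable_cst.
exact: val_bounded_measurable.
Qed.

Let measurable_lhalf : measurable_fun setT lhalf.
Proof.
apply: measurable_val_comp; rewrite (_ : _ \o _ = fun x => 2^-1 * val x).
  by case: bounded_measurable_half.
by apply/funext => x; exact: val_lhalf.
Qed.

Let measurable_rhalf : measurable_fun setT rhalf.
Proof.
apply: measurable_val_comp; rewrite (_ : _ \o _ = fun x => 1 - 2^-1 * val x).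
  by case: (bounded_measurableB (bounded_measurable_cst _ 1) bounded_measurable_half).
by apply/funext => x; exact: val_rhalf.
Qed.

Let measurable_flip : measurable_fun setT flip.
Proof.
apply: measurable_val_comp; rewrite (_ : _ \o _ = fun x => 1 - val x).
  by case: (bounded_measurableB (bounded_measurable_cst _ 1) (val_bounded_measurable R)).
by apply/funext => x; exact: val_flip.
Qed.

Let measurable_tent : measurable_fun setT tent.
Proof.
apply: measurable_val_comp; rewrite (_ : _ \o _ = fun x => 1 - `|1 - 2 * val x|).
  have [] // := bounded_measurableB (bounded_measurable_cst _ 1)
    (bounded_measurable_norm (bounded_measurableB (bounded_measurable_cst _ 1)
      (bounded_measurableM (bounded_measurable_cst _ 2) (val_bounded_measurable R)))).
by apply/funext => x; exact: val_tent.
Qed.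

HB.instance Definition _ := isMeasurableFun.Build _ _ _ _ lhalf measurable_lhalf.
HB.instance Definition _ := isMeasurableFun.Build _ _ _ _ rhalf measurable_rhalf.
HB.instance Definition _ := isMeasurableFun.Build _ _ _ _ flip measurable_flip.
HB.instance Definition _ := isMeasurableFun.Build _ _ _ _ tent measurable_tent.

Lemma flipK : involutive flip.
Proof. by move=> x; apply: val_inj; rewrite !val_flip subKr. Qed.

Lemma lhalfK : cancel lhalf tent.
Proof.
move=> x; apply: val_inj; rewrite val_tent val_lhalf.
have /andP[x0 x1] := unit_interval_bounds x.
by rewrite ger0_norm; lra.
Qed.

Lemma rhalfK : cancel rhalf tent.
Proof.
move=> x; apply: val_inj; rewrite val_tent val_rhalf.
have /andP[x0 x1] := unit_interval_bounds x.
by rewrite ler0_norm; lra.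
Qed.

Lemma flip_lhalf x : flip (lhalf x) = rhalf x.
Proof. by apply: val_inj; rewrite val_flip val_lhalf val_rhalf. Qed.

Lemma flip_rhalf x : flip (rhalf x) = lhalf x.
Proof. by rewrite -flip_lhalf flipK. Qed.

Let half_ge0 : 0 <= 2^-1 :> R. Proof. by rewrite invr_ge0. Qed.
Let half_le1 : 2^-1 <= 1 :> R. Proof. by rewrite invf_le1// ler1n. Qed.

Definition half : {i01 R} := Itv01 half_ge0 half_le1.

Definition spread mu : Prob I01 := push lhalf mu <| half |> push rhalf mu.

Lemma spreadE mu (A : set (Borel I01)) : measurable A ->
  spread mu A = (2^-1%:E * mu (lhalf @^-1` A) + 2^-1%:E * mu (rhalf @^-1` A))%E.
Proof.
move=> mA; rewrite Prob_convE// !pushE//=.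
by rewrite (_ : 1 - 2^-1 = 2^-1 :> R)//; lra.
Qed.

Lemma expect_spread mu f : nonexpansive f ->
  \int[spread mu]_x f x = \int[mu]_x (2^-1 * (f (lhalf x) + f (rhalf x))).
Proof.
move=> f1; have bf := nonexpansive_bounded_measurable f1.
have bl : bounded_measurable (f \o lhalf : Borel I01 -> R).
  case: bf => mf [M fM]; split; last by exists M => x; exact: fM.
  exact: measurableT_comp.
have br : bounded_measurable (f \o rhalf : Borel I01 -> R).
  case: bf => mf [M fM]; split; last by exists M => x; exact: fM.
  exact: measurableT_comp.
rewrite expect_conv// !expect_push// expectZ; last exact: bounded_measurableD.
by rewrite expectD//=; lra.
Qed.

Lemma spread_affine mu nu (t : {i01 R}) :
  spread (mu <| t |> nu) = spread mu <| t |> spread nu.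
Proof.
apply: Prob_eqP => A mA; rewrite spreadE// [RHS]Prob_convE// !spreadE//.
have ml : measurable (lhalf @^-1` A) by exact: measurable_mfun_preimage.
have mr : measurable (rhalf @^-1` A) by exact: measurable_mfun_preimage.
rewrite !Prob_convE//.
rewrite -(fineK (fin_num_measure mu _ ml)) -(fineK (fin_num_measure nu _ ml)).
rewrite -(fineK (fin_num_measure mu _ mr)) -(fineK (fin_num_measure nu _ mr)).
by rewrite -!(EFinM, EFinD); congr EFin; ring.
Qed.

(** [tent] is a common left inverse of [lhalf] and [rhalf], so pushing along it returns both terms
    of the average to [mu]. *)
Lemma spreadK : cancel spread (push tent).
Proof.
move=> mu; rewrite /spread push_conv.
by rewrite (push_id _ lhalfK) (push_id _ rhalfK) convmm.
Qed.

(** The flip exchanges [lhalf] and [rhalf], hence the two terms of the average, whose weights are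
    equal. *)
Lemma push_flip_spread mu : push flip (spread mu) = spread mu.
Proof.
rewrite /spread push_conv (push_comp _ flip_lhalf) (push_comp _ flip_rhalf) convC.
by congr (_ <| _ |> _); apply: val_inj => /=; lra.
Qed.

(** On the upper half [U], [rhalf \o tent] is the identity and [lhalf \o tent] is the flip; off [U]
    the roles are exchanged. Summing the four pieces gives the average of the masses of [A] and of
    its flipped copy, which agree by symmetry. *)
Lemma spread_tent mu : push flip mu = mu -> spread (push tent mu) = mu.
Proof.
move=> mu_sym; apply: Prob_eqP => A mA; rewrite spreadE//.
have mf : measurable (flip @^-1` A) by exact: measurable_mfun_preimage.
have ml : measurable (lhalf @^-1` A) by exact: measurable_mfun_preimage.
have mr : measurable (rhalf @^-1` A) by exact: measurable_mfun_preimage.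
rewrite !pushE//.
pose U : set (Borel I01) := [set x | 2^-1 <= val x].
have mU : measurable U by exact: measurable_upper_ray.
have flipA : mu (flip @^-1` A) = mu A by rewrite -[in RHS]mu_sym pushE.
have tentUl x : U x -> lhalf (tent x) = flip x.
  move=> Ux; apply: val_inj; rewrite val_lhalf val_tent val_flip.
  by rewrite ler0_norm; move: Ux; rewrite /U /=; lra.
have tentUr x : U x -> rhalf (tent x) = x.
  move=> Ux; apply: val_inj; rewrite val_rhalf val_tent.
  by rewrite ler0_norm; move: Ux; rewrite /U /=; lra.
have tentCl x : ~ U x -> lhalf (tent x) = x.
  move=> /negP; rewrite -ltNge => Ux; apply: val_inj; rewrite val_lhalf val_tent.
  by rewrite ger0_norm; lra.
have tentCr x : ~ U x -> rhalf (tent x) = flip x.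
  move=> /negP; rewrite -ltNge => Ux; apply: val_inj; rewrite val_rhalf val_tent val_flip.
  by rewrite ger0_norm; lra.
have split_U (B : set (Borel I01)) : measurable B -> mu B = (mu (B `&` U) + mu (B `\` U))%E.
  by move=> mB; rewrite addeC -measureDI.
rewrite (split_U (tent @^-1` (lhalf @^-1` A))); last exact: measurable_mfun_preimage.
rewrite (split_U (tent @^-1` (rhalf @^-1` A))); last exact: measurable_mfun_preimage.
have eq_on (phi psi : Borel I01 -> Borel I01) (V : set (Borel I01)) :
    (forall x, V x -> phi x = psi x) -> phi @^-1` A `&` V = psi @^-1` A `&` V.
  move=> phi_psi; apply/seteqP; split=> x [/= Ax Vx]; split=> //=.
    by rewrite -phi_psi.
  by rewrite phi_psi.
rewrite !setDE.
rewrite (eq_on (lhalf \o tent) flip U)// (eq_on (lhalf \o tent) id (~` U))//.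
rewrite (eq_on (rhalf \o tent) id U)// (eq_on (rhalf \o tent) flip (~` U))//.
rewrite -!setDE !preimage_id.
have := split_U _ mf; have := split_U _ mA; rewrite flipA.
have fin (B : set (Borel I01)) : measurable B -> mu B = (fine (mu B))%:E.
  by move=> mB; rewrite fineK// fin_num_measure.
have mAU := measurableI _ _ mA mU; have mAV := measurableD mA mU.
have mFU := measurableI _ _ mf mU; have mFV := measurableD mf mU.
rewrite (fin A)// (fin _ mAU) (fin _ mAV) (fin _ mFU) (fin _ mFV).
by rewrite -!(EFinM, EFinD) => -[AE] [FE]; congr EFin; lra.
Qed.

(** Test functions are transferred both ways. The halving maps have Lipschitz constant 1/2, so the
    sum of [f \o lhalf] and [f \o rhalf] is nonexpansive; [tent] has Lipschitz constant 2, so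
    [2^-1 * f (tent x)] is nonexpansive, and composing it with either half gives back
    [2^-1 * f x]. *)
Lemma kantorovich_spread mu nu :
  kantorovich (spread mu) (spread nu) = 2^-1 * kantorovich mu nu.
Proof.
apply/eqP; rewrite eq_le; apply/andP; split.
  apply: kantorovich_le => f f1; rewrite !expect_spread//.
  pose g (x : I01) := f (lhalf x) + f (rhalf x).
  have g1 : nonexpansive g.
    move=> x y; have := f1 (lhalf x) (lhalf y); have := f1 (rhalf x) (rhalf y).
    rewrite !unit_interval_mdistE !val_lhalf !val_rhalf.
    have -> : 1 - 2^-1 * val x - (1 - 2^-1 * val y) = 2^-1 * (val y - val x) by ring.
    rewrite -mulrBr !normrM ger0_norm// (distrC (val y)) => fr fl.
    rewrite /g opprD addrACA; apply: le_trans (ler_normD _ _) _.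
    by move: fr fl; set d := `|val x - val y|; lra.
  have bg := nonexpansive_bounded_measurable g1.
  rewrite !expectZ// -mulrBr normrM ger0_norm// ler_pM2l ?invr_gt0//.
  exact: le_kantorovich.
rewrite mulrC ler_pdivrMr//; apply: kantorovich_le => f f1.
pose g (x : I01) := 2^-1 * f (tent x).
have g1 : nonexpansive g.
  move=> x y; have := f1 (tent x) (tent y).
  rewrite !unit_interval_mdistE !val_tent /g -mulrBr normrM (@ger0_norm _ 2^-1)// => ft.
  have : `|1 - `|1 - 2 * val x| - (1 - `|1 - 2 * val y|)| <= 2 * `|val x - val y|.
    rewrite opprB addrC addrA subrK; apply: le_trans (ler_dist_dist _ _) _.
    have -> : 1 - 2 * val y - (1 - 2 * val x) = 2 * (val x - val y) by ring.
    by rewrite normrM ger0_norm.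
  by lra.
have := le_kantorovich (spread mu) (spread nu) g1; rewrite !expect_spread//.
have gE (m : Prob I01) : \int[m]_x (2^-1 * (g (lhalf x) + g (rhalf x))) =
    2^-1 * \int[m]_x f x.
  rewrite -expectZ; last exact: nonexpansive_bounded_measurable.
  by apply: eq_Rintegral => x _; rewrite /g lhalfK rhalfK; lra.
by rewrite !gE -mulrBr normrM ger0_norm//; lra.
Qed.

Lemma kantorovich_flip mu nu :
  kantorovich (push flip mu) (push flip nu) = kantorovich mu nu.
Proof.
suff le_flip m n : kantorovich (push flip m) (push flip n) <= kantorovich m n.
  apply/eqP; rewrite eq_le le_flip /=.
  by have := le_flip (push flip mu) (push flip nu); rewrite !(push_id _ flipK).
apply: kantorovich_le => f f1; have bf := nonexpansive_bounded_measurable f1.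
rewrite !expect_push//; apply: (@le_kantorovich _ _ _ (f \o flip)) => x y.
apply: le_trans (f1 _ _) _.
by rewrite !unit_interval_mdistE !val_flip opprB addrC addrA subrK distrC.
Qed.

Lemma affine_isometry_flip : affine_isometry kantorovich setT (push flip).
Proof.
split=> [|mu nu _ _|mu nu t _ _]; [|exact: kantorovich_flip|exact: push_conv].
rewrite -subTset => mu _; exists (push flip mu) => //.
exact: push_id flipK.
Qed.

End tent.

(** * Affine isometries of the space of measures *)

Section affine_isometries.
Context (R : realType).
Local Notation I01 := (unit_interval R).
Local Notation val := (\val : I01 -> R).
Local Notation mean mu := (\int[mu]_x val x).
Local Notation delta0 := (Dirac (clamp 0 : I01)).
Local Notation delta1 := (Dirac (clamp 1 : I01)).
Implicit Types (mu nu : Prob I01) (Phi : Prob I01 -> Prob I01).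

Lemma val_clamp0 : val (clamp 0) = 0.
Proof. by rewrite clampE// lexx ler01. Qed.

Lemma val_clamp1 : val (clamp 1) = 1.
Proof. by rewrite clampE// lexx ler01. Qed.

Lemma kantorovich_delta0 mu : kantorovich mu delta0 = mean mu.
Proof.
rewrite kantorovich_Dirac val_clamp0; apply: eq_Rintegral => x _.
by rewrite subr0 ger0_norm//; have /andP[] := unit_interval_bounds x.
Qed.

Lemma kantorovich_delta1 mu : kantorovich mu delta1 = 1 - mean mu.
Proof.
rewrite kantorovich_Dirac val_clamp1 -[X in X - _](expect_cst mu) -expectB.
- apply: eq_Rintegral => x _; rewrite distrC ger0_norm// subr_ge0.
  by have /andP[] := unit_interval_bounds x.
- exact: bounded_measurable_cst.
- exact: val_bounded_measurable.
Qed.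

(** With means [a] and [b], the bound [a * (1 - b) + b * (1 - a)] equals 1 minus
    [a * b + (1 - a) * (1 - b)]. Both products therefore vanish, so one mean is 0 and the other is
    1; these means are the distances to the Dirac measure at 0. *)
Lemma kantorovich_eq1 mu nu : kantorovich mu nu = 1 ->
  (mu = delta0 /\ nu = delta1) \/ (mu = delta1 /\ nu = delta0).
Proof.
move=> d1; have := kantorovich_le_means mu nu; rewrite d1.
have := mean_bounds nu; have := mean_bounds mu.
set a := mean mu; set b := mean nu => /andP[a0 a1] /andP[b0 b1] ab.
have ab0 : a * b = 0 by apply/eqP; rewrite eq_le mulr_ge0// andbT; nra.
have cd0 : (1 - a) * (1 - b) = 0.
  by apply/eqP; rewrite eq_le mulr_ge0 ?subr_ge0// andbT; nra.
move/eqP : ab0; rewrite mulf_eq0 => /orP[]/eqP z.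
  left; split; apply: kantorovich_eq0; first by rewrite kantorovich_delta0.
  by rewrite kantorovich_delta1 -/b; move: cd0; rewrite z subr0 mul1r.
right; split; apply: kantorovich_eq0; last by rewrite kantorovich_delta0.
by rewrite kantorovich_delta1 -/a; move: cd0; rewrite z subr0 mulr1.
Qed.

Section chord.
Variable c : I01.

Let c_ge0 : 0 <= val c. Proof. by have /andP[] := unit_interval_bounds c. Qed.
Let c_le1 : val c <= 1. Proof. by have /andP[] := unit_interval_bounds c. Qed.

(** The mixture of the two end Dirac measures that has mean [val c]. An affine map fixing both ends
    fixes it. *)
Definition chord : Prob I01 := delta1 <| Itv01 c_ge0 c_le1 |> delta0.

Lemma expect_chord f : nonexpansive f ->
  \int[chord]_x f x = val c * f (clamp 1) + (1 - val c) * f (clamp 0).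
Proof.
move=> f1; have bf := nonexpansive_bounded_measurable f1.
by rewrite expect_conv// !expect_Dirac.
Qed.

(** The lower bound comes from the test function [|val x - val c|], whose value is 0 at [c], [val c]
    at 0 and [1 - val c] at 1. *)
Lemma kantorovich_Dirac_chord :
  2 * val c - 2 * val c ^+ 2 <= kantorovich (Dirac c) chord.
Proof.
have n1 := @nonexpansive_norm R (val c).
have := le_kantorovich (Dirac c) chord n1.
rewrite expect_Dirac; last exact: nonexpansive_bounded_measurable.
rewrite expect_chord// val_clamp0 val_clamp1 subrr normr0 sub0r normrN.
rewrite sub0r normrN (ger0_norm c_ge0) (ger0_norm (_ : 0 <= 1 - _)) ?subr_ge0//.
by apply: le_trans; apply: le_trans (ler_norm _); nra.
Qed.

(** As the means agree, the difference of integrals is the [mu]-integral of [f] minus its secant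
    through the endpoints. That difference is [x * (f x - f 1) + (1 - x) * (f x - f 0)], at most
    [2 * x * (1 - x)] in absolute value. *)
Lemma kantorovich_chord_le mu : mean mu = val c ->
  kantorovich mu chord <= 2 * val c - 2 * \int[mu]_x (val x * val x).
Proof.
move=> mu_c; apply: kantorovich_le => f f1; rewrite expect_chord//.
have bf := nonexpansive_bounded_measurable f1.
have bv := val_bounded_measurable R.
have bk r := @bounded_measurable_cst _ (Borel I01) R r.
have bM := bounded_measurableM; have bD := bounded_measurableD.
have bB := bounded_measurableB; have bN := bounded_measurable_norm.
set f0 := f (clamp 0); set f1' := f (clamp 1).
have b1 : bounded_measurable (fun x : Borel I01 => (f1' - f0) * val x) by exact: bM.
have b2 : bounded_measurable (fun x : Borel I01 => f0 + (f1' - f0) * val x) by exact: bD.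
have b3 : bounded_measurable (fun x : Borel I01 => val x - val x * val x).
  by apply: bB => //; exact: bM.
have -> : \int[mu]_x f x - (val c * f1' + (1 - val c) * f0) =
    \int[mu]_x (f x - (f0 + (f1' - f0) * val x)).
  by rewrite expectB// expectD// expectZ// expect_cst mu_c; ring.
apply: le_trans (le_norm_expect _ _) _; first exact: bB.
have -> : 2 * val c - 2 * \int[mu]_x (val x * val x) =
    \int[mu]_x (2 * (val x - val x * val x)).
  by rewrite expectZ// expectB// ?mu_c; [ring|exact: bM].
apply: le_expect => [||x]; [exact/bN/bB|exact: bM|].
have /andP[x0 x1] := unit_interval_bounds x.
have -> : f x - (f0 + (f1' - f0) * val x) =
  val x * (f x - f1') + (1 - val x) * (f x - f0) by ring.
apply: le_trans (ler_normD _ _) _; rewrite !normrM.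
have := f1 x (clamp 0); have := f1 x (clamp 1).
rewrite !unit_interval_mdistE val_clamp0 val_clamp1 -/f0 -/f1' subr0.
rewrite (ger0_norm x0) (ger0_norm (_ : 0 <= 1 - val x)) ?subr_ge0//.
by rewrite (distrC (val x)) (ger0_norm (_ : 0 <= 1 - val x)) ?subr_ge0//; nra.
Qed.

End chord.

(* A measure of mean c lies within int 2 x (1 - x) dmu of the chord measure, with
   equality at the Dirac measure, so mu has variance 0 by Jensen's inequality. *)
Lemma eq_Dirac mu (c : I01) : mean mu = val c ->
  kantorovich mu (chord c) = kantorovich (Dirac c) (chord c) -> mu = Dirac c.
Proof.
move=> mu_c d_eq.
have := kantorovich_chord_le mu_c; rewrite d_eq => le1.
have := le_trans (kantorovich_Dirac_chord c) le1 => {d_eq le1} var.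
have bv := val_bounded_measurable R.
have bk r := @bounded_measurable_cst _ (Borel I01) R r.
have bn := nonexpansive_bounded_measurable (@nonexpansive_norm R (val c)).
have bvv := bounded_measurableM bv bv.
apply: kantorovich_eq0; rewrite kantorovich_Dirac.
set u := \int[mu]_x `|val x - val c|.
have u_ge0 : 0 <= u by exact: Rintegral_ge0.
(* The inequality [2 * u * s <= s ^+ 2 + u ^+ 2] with [s] the distance to [c], expanded under the
   integral. It yields [u ^+ 2] at most the variance, which [var] makes nonpositive. *)
have : \int[mu]_x ((2 * u) * `|val x - val c|) <=
    \int[mu]_x (val x * val x + ((- 2 * val c) * val x + (val c ^+ 2 + u ^+ 2))).
  apply: le_expect => [||x].
  - exact: bounded_measurableM.
  - apply: bounded_measurableD => //; apply: bounded_measurableD => //.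
    exact: bounded_measurableM.
  - have : `|val x - val c| ^+ 2 = (val x - val c) ^+ 2 by rewrite real_normK ?num_real.
    by have := sqr_ge0 (`|val x - val c| - u); nra.
rewrite expectZ// expectD//; last first.
  by apply: bounded_measurableD => //; exact: bounded_measurableM.
rewrite expectD//; last exact: bounded_measurableM.
rewrite expectZ// expect_cst mu_c -/u => u_le.
by apply/eqP; rewrite -sqrf_eq0 eq_le sqr_ge0 andbT; nra.
Qed.

Lemma affine_isometry_id Phi : affine_isometry kantorovich setT Phi ->
  Phi delta0 = delta0 -> Phi delta1 = delta1 -> forall mu, Phi mu = mu.
Proof.
move=> [_ Phi_dist Phi_affine] Phi0 Phi1.
have Phi_Dirac c : Phi (Dirac c) = Dirac c.
  apply: eq_Dirac; last first.
    by rewrite -[chord c in LHS](_ : Phi (chord c) = _) ?Phi_dist// Phi_affine// Phi0 Phi1.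
  (* The mean is the distance to [delta0], a fixed point of [Phi], so [Phi] preserves means. *)
  rewrite -kantorovich_delta0 -Phi0 Phi_dist// kantorovich_delta0 expect_Dirac//.
  exact: val_bounded_measurable.
move=> mu; apply: expect_norm_inj => c.
by rewrite -!kantorovich_Dirac -[in LHS]Phi_Dirac Phi_dist.
Qed.

Lemma push_flip_Dirac (c : I01) : push (@flip R) (Dirac c) = Dirac (flip c).
Proof.
apply: Prob_eqP => A mA.
have mf : measurable (@flip R @^-1` A) by exact: measurable_mfun_preimage.
by rewrite pushE// !Prob_ofE//.
Qed.

Lemma flip_clamp0 : flip (clamp 0) = clamp 1 :> I01.
Proof. by apply: val_inj; rewrite val_flip val_clamp0 val_clamp1 subr0. Qed.

Lemma affine_isometry_comp (Phi Psi : Prob I01 -> Prob I01) :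
  affine_isometry kantorovich setT Phi -> affine_isometry kantorovich setT Psi ->
  affine_isometry kantorovich setT (Phi \o Psi).
Proof.
move=> [PhiT Phi_dist Phi_affine] [PsiT Psi_dist Psi_affine].
split=> [|mu nu _ _|mu nu t _ _] /=.
- by rewrite -image_comp PsiT.
- by rewrite Phi_dist ?Psi_dist.
- by rewrite Psi_affine ?Phi_affine.
Qed.

Lemma affine_isometry_unit_interval Phi : affine_isometry kantorovich setT Phi ->
  (forall mu, Phi mu = mu) \/ (forall mu, Phi mu = push (@flip R) mu).
Proof.
move=> isoPhi; have [_ Phi_dist _] := isoPhi.
have flip0 : push (@flip R) delta0 = delta1 by rewrite push_flip_Dirac flip_clamp0.
have flip1 : push (@flip R) delta1 = delta0.
  by rewrite -flip0 (push_id _ (@flipK R)).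
have : kantorovich (Phi delta0) (Phi delta1) = 1.
  rewrite Phi_dist// kantorovich_delta1 expect_Dirac ?val_clamp0 ?subr0//.
  exact: val_bounded_measurable.
case/kantorovich_eq1 => -[Phi0 Phi1]; first by left; exact: affine_isometry_id.
(* Here [Phi] exchanges the ends, so following it by the flip gives an affine isometry that fixes
   both. *)
right=> mu; have flipPhi : push (@flip R) (Phi mu) = mu.
  have isoflipPhi := affine_isometry_comp (affine_isometry_flip R) isoPhi.
  by apply: (affine_isometry_id isoflipPhi); rewrite /= ?Phi0 ?Phi1.
by rewrite -[in RHS]flipPhi (push_id _ (@flipK R)).
Qed.

Lemma Fix_Prob_unit_interval :
  Fix kantorovich [set: Prob I01] = @spread R @` setT.
Proof.
apply/seteqP; split=> [mu [_ mu_fixed]|_ [mu _ <-]].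
  by exists (push (@tent R) mu) => //; apply/spread_tent/mu_fixed/affine_isometry_flip.
split=> // Phi /affine_isometry_unit_interval[->//|->].
exact: push_flip_spread.
Qed.

End affine_isometries.

(** * Invariance of Lebesgue measure under [spread] *)

Section lebesgue_spread.
Context (R : realType).
Local Notation I01 := (unit_interval R).
Local Notation val := (\val : I01 -> R).

Lemma lebesgue01_ge (b : R) : 0 <= b <= 1 ->
  lebesgue01 R [set x | b <= val x] = (1 - b)%:E.
Proof.
move=> /andP[b0 b1]; rewrite lebesgue01E; last exact: measurable_upper_ray.
have -> : val @` [set x | b <= val x] = `[b, 1]%classic.
  apply/seteqP; split=> [_ [x /= bx <-]|x /=]; rewrite /= in_itv/=.
    by rewrite bx; have /andP[] := unit_interval_bounds x.
  by move=> /andP[bx x1]; exists (clamp x); rewrite /mkset clampE// (le_trans b0).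
rewrite lebesgue_measure_itv/= lte_fin.
(* The length formula branches on [b < 1]; the degenerate interval at [b = 1] has length 0, which
   agrees with [1 - b]. *)
by case: ltgtP b1 => // ->; rewrite subrr.
Qed.

Lemma lebesgue01_le (b : R) : 0 <= b <= 1 ->
  lebesgue01 R [set x | val x <= b] = b%:E.
Proof.
move=> /andP[b0 b1]; rewrite lebesgue01E; last first.
  rewrite [X in measurable X](_ : _ = setT `&` val @^-1` `]-oo, b]).
    by apply: measurable_val.
  by rewrite setTI; apply/seteqP; split=> x /=; rewrite in_itv.
have -> : val @` [set x | val x <= b] = `[0, b]%classic.
  apply/seteqP; split=> [_ [x /= xb <-]|x /=]; rewrite /= in_itv/=.
    by rewrite xb andbT; have /andP[] := unit_interval_bounds x.
  by move=> /andP[x0 xb]; exists (clamp x); rewrite /mkset clampE// x0 (le_trans xb).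
rewrite lebesgue_measure_itv/= lte_fin.
by case: ltgtP b0 => // [_|<-//]; rewrite oppr0 adde0.
Qed.

Lemma spread_lebesgue01 : spread (lebesgue01 R) = lebesgue01 R.
Proof.
apply: Prob_upper_ray_inj => a a01; rewrite spreadE; last exact: measurable_upper_ray.
have -> : @lhalf R @^-1` [set x | a <= val x] = [set x | 2 * a <= val x].
  by apply/seteqP; split=> x; rewrite /preimage /mkset val_lhalf; lra.
have -> : @rhalf R @^-1` [set x | a <= val x] = [set x | val x <= 2 - 2 * a].
  by apply/seteqP; split=> x; rewrite /preimage /mkset val_rhalf; lra.
rewrite [in RHS]lebesgue01_ge//.
(* For [2 * a <= 1] the second preimage is the whole interval and the masses average to
   [((1 - 2 * a) + 1) / 2]; otherwise the first is empty and they average to [(2 - 2 * a) / 2]. Both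
   are [1 - a]. *)
have [a2|a2] := leP (2 * a) 1.
  rewrite lebesgue01_ge; last lra.
  have -> : [set x | val x <= 2 - 2 * a] = setT.
    rewrite -subTset => x _; rewrite /mkset.
    by have /andP[x0 x1] := unit_interval_bounds x; lra.
  by rewrite probability_setT -!EFinM -EFinD; congr EFin; lra.
rewrite lebesgue01_le; last lra.
have -> : [set x | 2 * a <= val x] = set0.
  rewrite -subset0 => x; rewrite /mkset.
  by have /andP[x0 x1] := unit_interval_bounds x; lra.
by rewrite measure0 mule0 add0e -EFinM; congr EFin; lra.
Qed.

End lebesgue_spread.

Theorem proposition5p8 (R : realType) : central_measure2 (lebesgue01 R).
Proof.
have half_neq0 : 2^-1 != 0 :> R by rewrite invr_neq0// pnatr_eq0.
have iterE n := iter_Fix_dilation (@spreadK R) (@spread_affine R) half_neq0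
  (@kantorovich_spread R) n (Fix_Prob_unit_interval R).
have iter_lebesgue01 n : iter n (@spread R) (lebesgue01 R) = lebesgue01 R.
  by elim: n => //= n ->; exact: spread_lebesgue01.
have iter_dist n mu nu : kantorovich (iter n (@spread R) mu) (iter n (@spread R) nu) =
    2^-1 ^+ n * kantorovich mu nu.
  by elim: n => [|n IHn]; rewrite ?mul1r//= kantorovich_spread IHn mulrA exprS.
apply/seteqP; split=> [mu Delta_mu|_ -> n _]; last first.
  by rewrite iterE; exists (lebesgue01 R).
apply: kantorovich_eq0; apply/eqP; rewrite eq_le kantorovich_ge0 andbT.
(* Both measures are values of the [n]-th iterate of [spread], so their distance is at most
   [2^-1 ^+ n] for every [n]. *)
have : (2^-1 : R) ^+ n @[n --> \oo] --> 0.
  by apply: cvg_expr; rewrite ger0_norm ?invr_ge0// invf_lt1// ltr1n.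
move/cvgr_to_ge; apply; near=> n.
have := Delta_mu n Logic.I; rewrite iterE => -[mu' _ <-].
rewrite -(iter_lebesgue01 n) iter_dist ler_piMr ?exprn_ge0 ?invr_ge0//.
exact: kantorovich_le1.
Unshelve. all: by end_near. Qed.
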